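(* Let $d\ge 1$ be an integer and let $\beta\in[0,d]$. (i) For every $f\in L^1(\mathcal S_d)$, the set $\mathcal E(\beta,f)$ satisfies $\dim_{\mathcal H}\big(\mathcal E(\beta,f)\big)\le d-\beta$. (ii) Conversely, for every subset $E\subset \mathcal S_d$ with $\dim_{\mathcal H}(E)<d-\beta$, there exists $f\in L^1(\mathcal S_d)$ such that $E\subset\mathcal E(\beta,f)$.
   Context: $\mathcal S_d$ is the Euclidean unit sphere of $\mathbb R^{d+1}$ with the metric inherited from the Euclidean norm $\|\cdot\|$ of $\mathbb R^{d+1}$; $\sigma$ is the normalized Lebesgue (surface) measure on $\mathcal S_d$, and $L^1(\mathcal S_d)=L^1(\mathcal S_d,\sigma)$. For $x$ in the open unit ball and $\xi\in\mathcal S_d$, the Poisson kernel is $P(x,\xi)=\frac{1-\|x\|^2}{\|x-\xi\|^{d+1}}$, and $P[f](x)=\int_{\mathcal S_d}P(x,\xi)f(\xi)\,d\sigma(\xi)$. For $\beta\in[0,d]$ and $f\in L^1(\mathcal S_d)$, $$\mathcal E(\beta,f)=\Big\{y\in\mathcal S_d:\ \limsup_{r\to1^-}\frac{|P[f](ry)|}{(1-r)^{-\beta}}=+\infty\Big\}.$$ $\dim_{\mathcal H}$ denotes Hausdorff dimension (with $\dim_{\mathcal H}(\varnothing)=0$). *)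

(* Defs.v *)
From HB Require Import structures.
From mathcomp Require Import all_boot all_order all_algebra.
From mathcomp Require Import all_classical all_reals all_analysis.
From mathcomp Require Import measurable_realfun.

Set Implicit Arguments.
Unset Strict Implicit.
Unset Printing Implicit Defensive.

Import Order.TTheory GRing.Theory Num.Theory.
Import numFieldNormedType.Exports.

Local Open Scope classical_set_scope.
Local Open Scope ring_scope.

(* 'rV[T]_n carries the product sigma-algebra, generated by the coordinates; *)
(* on 'rV[R]_n it is the Borel sigma-algebra.                                *)
Definition measure_rV_display : measure_display -> measure_display.
Proof. exact. Qed.

Section measurable_rV.
Context {d} {T : measurableType d}.
Variable n : nat.

Let coors : 'I_n -> 'rV[T]_n -> T := fun i x => x ord0 i.

Let rV_set0 : g_sigma_preimage coors set0.
Proof. exact: sigma_algebra0. Qed.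

Let rV_setC A : g_sigma_preimage coors A -> g_sigma_preimage coors (~` A).
Proof. exact: sigma_algebraC. Qed.

Let rV_bigcup (F : (set 'rV[T]_n)^nat) :
  (forall i, g_sigma_preimage coors (F i)) ->
  g_sigma_preimage coors (\bigcup_i (F i)).
Proof. exact: sigma_algebra_bigcup. Qed.

HB.instance Definition _ := @isMeasurable.Build (measure_rV_display d)
  'rV[T]_n (g_sigma_preimage coors) rV_set0 rV_setC rV_bigcup.

End measurable_rV.

Lemma measurable_coord d (T : measurableType d) n (i : 'I_n) :
  measurable_fun [set: 'rV[T]_n] (fun x : 'rV[T]_n => x ord0 i).
Proof.
move=> _ Y mY; rewrite setTI; apply: sub_sigma_algebra => /=.
rewrite -bigcup_seq/=; exists i => /=; first by rewrite mem_index_enum.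
by exists Y => //; rewrite setTI.
Qed.

Lemma measurable_fun_coordP d1 d2 (T1 : measurableType d1)
    (T2 : measurableType d2) n (f : T1 -> 'rV[T2]_n) :
  measurable_fun [set: T1] f <->
  forall i, measurable_fun [set: T1] (fun x => f x ord0 i).
Proof.
split=> [mf i|mf].
  exact: (measurableT_comp (measurable_coord i) mf).
move=> _ A mA; rewrite setTI.
pose G := [set B | measurable (f @^-1` B)].
suff : G A by [].
apply: mA; split.
  split=> [|B GB|F GF].
  - by rewrite /G/= preimage_set0.
  - by rewrite /G/= setTD preimage_setC; exact: measurableC.
  - by rewrite /G/= preimage_bigcup; apply: bigcup_measurable => k _; exact: GF.
move=> B /=; rewrite -bigcup_seq => -[i _ [C mC <-]].
rewrite /G/= setTI.
by have := mf i measurableT C mC; rewrite setTI.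
Qed.

Section image_measure.
Context d1 d2 (T1 : measurableType d1) (T2 : measurableType d2) (R : realType).
Context (mu : {measure set T1 -> \bar R}) (f : T1 -> T2).
Hypothesis mf : measurable_fun [set: T1] f.

(* mf is an argument only so that the measure structure can be inferred. *)
Definition image_measure of measurable_fun [set: T1] f : set T2 -> \bar R :=
  pushforward mu f.

Local Notation m := (image_measure mf).

Let image0 : m set0 = 0%E.
Proof. by rewrite /m /pushforward preimage_set0 measure0. Qed.

Let image_ge0 A : (0 <= m A)%E.
Proof. exact: measure_ge0. Qed.

Let image_sigma_additive : semi_sigma_additive m.
Proof. exact: (@measure_semi_sigma_additive _ _ _ (pushforward mu f)). Qed.

HB.instance Definition _ := isMeasure.Build _ _ _ m
  image0 image_ge0 image_sigma_additive.

End image_measure.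
Arguments image_measure {d1 d2 T1 T2 R} mu {f}.

Section lebesgue_rV.
Context (R : realType).

Definition rV_cons n (p : 'rV[R]_n * R) : 'rV[R]_n.+1 :=
  row_mx (p.2%:M : 'rV[R]_1) p.1.

Lemma measurable_rV_cons n : measurable_fun [set: 'rV[R]_n * R] (@rV_cons n).
Proof.
apply/measurable_fun_coordP => i.
case: (split_ordP (i : 'I_(1 + n))) => j ->.
  rewrite (_ : (fun p => _) = snd); first exact: measurable_snd.
  by apply/funext => p; rewrite [LHS]row_mxEl mxE (ord1 j) eqxx mulr1n.
rewrite (_ : (fun p => _) = (fun x : 'rV[R]_n => x ord0 j) \o fst).
  exact: (measurableT_comp (measurable_coord j) measurable_fst).
by apply/funext => p; rewrite [LHS]row_mxEr.
Qed.

Fixpoint lebesgue_rV n : {measure set 'rV[R]_n -> \bar R} :=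
  match n with
  | 0 => \d_(0 : 'rV[R]_0)
  | n'.+1 => image_measure (lebesgue_rV n' \x lebesgue_measure)%E
                           (@measurable_rV_cons n')
  end.

End lebesgue_rV.

Section euclidean.
Context {R : realType}.

(* The norm of the library's normed structure on 'rV[R]_n is the sup norm. *)
Definition enorm n (x : 'rV[R]_n) : R := Num.sqrt (\sum_(i < n) x ord0 i ^+ 2).

Definition unit_sphere n : set 'rV[R]_n := [set x | enorm x = 1].

Definition unit_cball n : set 'rV[R]_n := [set x | enorm x <= 1].

Definition radial_proj n (x : 'rV[R]_n) : 'rV[R]_n := (enorm x)^-1 *: x.

Lemma measurable_enorm n : measurable_fun [set: 'rV[R]_n] (@enorm n).
Proof.
rewrite (_ : @enorm n = (fun t : R => t `^ 2^-1) \o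
    (fun x : 'rV[R]_n => \sum_(i < n) x ord0 i ^+ 2)).
  apply: measurableT_comp; first exact: measurable_powR.
  apply: measurable_sum => i; apply: measurable_funX.
  exact: measurable_coord.
apply/funext => x /=; rewrite powR12_sqrt//.
by apply: sumr_ge0 => i _; exact: sqr_ge0.
Qed.

Lemma measurable_unit_cball n : measurable (@unit_cball n).
Proof.
rewrite (_ : @unit_cball n = @enorm n @^-1` [set` `]-oo, 1]]).
  by rewrite -[X in measurable X]setTI; exact: measurable_enorm.
by apply/seteqP; split => x /=; rewrite in_itv.
Qed.

Lemma measurable_unit_sphere n : measurable (@unit_sphere n).
Proof.
rewrite (_ : @unit_sphere n = @enorm n @^-1` [set 1]) //.
by rewrite -[X in measurable X]setTI; exact: measurable_enorm.
Qed.

Lemma measurable_radial_proj n :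
  measurable_fun [set: 'rV[R]_n] (@radial_proj n).
Proof.
apply/measurable_fun_coordP => i.
rewrite (_ : (fun x => _) = ((fun t : R => t `^ (-1)) \o @enorm n) \*
    (fun x : 'rV[R]_n => x ord0 i)).
  apply: measurable_funM; last exact: measurable_coord.
  by apply: measurableT_comp; [exact: measurable_powR|exact: measurable_enorm].
by apply/funext => x /=; rewrite mxE powR_inv1// sqrtr_ge0.
Qed.

Lemma ball_scale_ge0 n : 0 <= (fine (lebesgue_rV R n (@unit_cball n)))^-1.
Proof. by rewrite invr_ge0 fine_ge0. Qed.

(* Polar-coordinates definition of the normalized surface measure: the       *)
(* measure of A is the proportion of the volume of the unit ball filled by   *)
(* the cone { r *: y | 0 < r <= 1, y \in A } over A. It is a measure on      *)
(* 'rV[R]_n carried by unit_sphere n (for 0 < n).                            *)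
Definition sphere_measure n : {measure set 'rV[R]_n -> \bar R} :=
  mscale (NngNum (ball_scale_ge0 n))
    (image_measure (mrestr (lebesgue_rV R n) (@measurable_unit_cball n))
       (@measurable_radial_proj n)).

End euclidean.
Arguments unit_sphere {R} n.
Arguments unit_cball {R} n.

Section hausdorff.
Context {R : realType} {n : nat}.
Implicit Types (U E : set 'rV[R]_n) (s delta : R).
Local Open Scope ereal_scope.

Definition ediam U : \bar R :=
  ereal_sup [set (enorm (x - y))%:E | x in U & y in U].

(* For s = 0 the term is 1 on nonempty sets and 0 on the empty set. *)
Definition diam_pow s U : \bar R :=
  if U == set0 then 0 else ediam U `^ s.

Definition hausdorff_premeasure s delta E : \bar R :=
  ereal_inf [set \sum_(0 <= i <oo) diam_pow s (U i) |
    U in [set U : (set 'rV[R]_n)^nat |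
      E `<=` \bigcup_i U i /\ forall i, ediam (U i) <= delta%:E]].

Definition hausdorff_measure s E : \bar R :=
  ereal_sup [set hausdorff_premeasure s delta E |
    delta in [set delta : R | (0 < delta)%R]].

Definition hausdorff_dim E : \bar R :=
  ereal_inf [set s%:E | s in [set s : R | (0 <= s)%R /\
                                          hausdorff_measure s E = 0]].

End hausdorff.

Section poisson.
Context {R : realType} {d : nat}.
Implicit Types (x y xi : 'rV[R]_d.+1) (f : 'rV[R]_d.+1 -> R).

(* Only the values of f on the unit sphere are relevant. *)
Definition L1_sphere f : Prop :=
  (sphere_measure d.+1).-integrable (unit_sphere d.+1) (EFin \o f).

Definition poisson_kernel x xi : R :=
  (1 - enorm x ^+ 2) / enorm (x - xi) ^+ d.+1.

Definition poisson_integral f x : R :=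
  \int[sphere_measure d.+1]_(xi in unit_sphere d.+1)
    (poisson_kernel x xi * f xi).

Definition exceptional_set (beta : R) f : set 'rV[R]_d.+1 :=
  [set y | unit_sphere d.+1 y /\
    limf_esup (fun r : R =>
      (`|poisson_integral f (r *: y)| / (1 - r) `^ (- beta))%:E) 1^'- = +oo%E].

End poisson.

(* Main.v *)
(* Let mu be the measure |f| sigma. A dyadic decomposition of the Poisson kernel
   bounds |P[f](ry)| by a sum over k of (2^k (1-r))^-d 2^-k mu(B(y, 2^k (1-r))),
   up to a constant, so that y can be exceptional only if the ratios
   mu(B(y, rho)) / rho^(d - beta) are unbounded as rho tends to 0. By Vitali's
   covering argument, the set of these y is H^(d - beta)-null.
   Conversely, if dim E < s < d - beta, then E has covers by balls whose radii
   are small and have small s-th powers in total; let f be the sum of the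
   indicators of these balls, normalized to have integral radius^s. The Poisson
   kernel at (1-r)y is at least a constant times r^-d on a ball of radius r near
   y, so P[f]((1-r)y) r^beta is at least a constant times r^(s - d + beta), which
   is unbounded as r tends to 0. *)

From HB Require Import structures.
Require Import Defs.
From mathcomp Require Import all_boot all_order all_algebra.
From mathcomp Require Import all_classical all_reals all_analysis.
From mathcomp Require Import measurable_realfun.
From mathcomp Require Import ring lra.

Set Implicit Arguments.
Unset Strict Implicit.
Unset Printing Implicit Defensive.

Import Order.TTheory GRing.Theory Num.Theory.
Import numFieldNormedType.Exports.

Local Open Scope classical_set_scope.
Local Open Scope ring_scope.

(** * Euclidean norm, balls and diameters *)

Section enorm_theory.
Context {R : realType} {n : nat}.
Implicit Types (x y z : 'rV[R]_n) (r : R).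

Lemma enorm_ge0 x : 0 <= enorm x.
Proof. exact: sqrtr_ge0. Qed.

Lemma sqr_enorm x : enorm x ^+ 2 = \sum_(i < n) x ord0 i ^+ 2.
Proof. by rewrite sqr_sqrtr// sumr_ge0// => i _; exact: sqr_ge0. Qed.

Lemma enorm0 : enorm (0 : 'rV[R]_n) = 0.
Proof.
by rewrite /enorm big1 ?sqrtr0// => i _; rewrite mxE expr0n.
Qed.

Lemma enormZ r x : enorm (r *: x) = `|r| * enorm x.
Proof.
rewrite /enorm -sqrtr_sqr -sqrtrM ?sqr_ge0// mulr_sumr.
by congr Num.sqrt; apply: eq_bigr => i _; rewrite mxE exprMn.
Qed.

Lemma enormN x : enorm (- x) = enorm x.
Proof. by rewrite -scaleN1r enormZ normrN1 mul1r. Qed.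

Lemma enorm_distC x y : enorm (x - y) = enorm (y - x).
Proof. by rewrite -enormN opprB. Qed.

Lemma enorm_eq0 x : enorm x = 0 -> x = 0.
Proof.
move=> x0; have : \sum_(i < n) x ord0 i ^+ 2 = 0 by rewrite -sqr_enorm x0 expr0n.
move=> /psumr_eq0P h; apply/rowP => i; rewrite mxE.
by apply/eqP; rewrite -sqrf_eq0; apply/eqP/h => // j _; exact: sqr_ge0.
Qed.

Lemma enorm_gt0 x : x != 0 -> 0 < enorm x.
Proof.
by rewrite lt0r enorm_ge0 andbT; apply: contra_neq; exact: enorm_eq0.
Qed.

(** Summing [(b * u - a * v) ^+ 2 >= 0] over the coordinates, with [a] and [b] the two norms, gives
    the inequality multiplied by [2 * (a * b)]; hence the separate treatment of zero vectors. *)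
Lemma enorm_CS x y : \sum_(i < n) x ord0 i * y ord0 i <= enorm x * enorm y.
Proof.
have [->|/enorm_gt0 x0] := eqVneq x 0.
  by rewrite enorm0 mul0r big1// => i _; rewrite mxE mul0r.
have [->|/enorm_gt0 y0] := eqVneq y 0.
  by rewrite enorm0 mulr0 big1// => i _; rewrite mxE mulr0.
rewrite -(@ler_pM2l _ (2 * (enorm x * enorm y))); last by rewrite !mulr_gt0.
have -> : 2 * (enorm x * enorm y) * (enorm x * enorm y) =
    enorm y ^+ 2 * enorm x ^+ 2 + enorm x ^+ 2 * enorm y ^+ 2 by ring.
rewrite [X in _ <= _ * X + _]sqr_enorm [X in _ <= _ + _ * X]sqr_enorm.
rewrite !mulr_sumr -big_split/=; apply: ler_sum => i _.
rewrite -subr_ge0; set a := enorm x; set b := enorm y.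
set u := x _ _; set v := y _ _.
by rewrite [X in 0 <= X](_ : _ = (b * u - a * v) ^+ 2) ?sqr_ge0//; ring.
Qed.

Lemma ler_enormD x y : enorm (x + y) <= enorm x + enorm y.
Proof.
rewrite -(@ler_pXn2r _ 2)// ?nnegrE ?addr_ge0 ?enorm_ge0//.
rewrite sqrrD !sqr_enorm.
have -> : \sum_(i < n) (x + y) ord0 i ^+ 2 = \sum_(i < n) x ord0 i ^+ 2 +
    (\sum_(i < n) x ord0 i * y ord0 i) *+ 2 + \sum_(i < n) y ord0 i ^+ 2.
  rewrite -sumrMnl -!big_split/=; apply: eq_bigr => i _.
  by rewrite mxE sqrrD.
by rewrite lerD2r lerD2l lerMn2r/= enorm_CS.
Qed.

Lemma ler_enorm_dist z x y : enorm (x - y) <= enorm (x - z) + enorm (z - y).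
Proof. by rewrite (le_trans _ (ler_enormD _ _))// addrA subrK. Qed.

Lemma coord_le_enorm x i : `|x ord0 i| <= enorm x.
Proof.
rewrite -(@ler_pXn2r _ 2)// ?nnegrE ?enorm_ge0//.
rewrite sqr_enorm real_normK ?num_real// (bigD1 i)//= lerDl.
by rewrite sumr_ge0// => j _; exact: sqr_ge0.
Qed.

(** The crude factor [n], in place of its square root, suffices for fitting cubes and rational
    points into Euclidean balls. *)
Lemma enorm_le_coord x r : 0 <= r -> (forall i, `|x ord0 i| <= r) ->
  enorm x <= n%:R * r.
Proof.
move=> r0 xr; rewrite -(@ler_pXn2r _ 2)// ?nnegrE ?mulr_ge0 ?enorm_ge0//.
rewrite sqr_enorm (@le_trans _ _ (\sum_(i < n) r ^+ 2))//.
  apply: ler_sum => i _.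
  by rewrite -(real_normK (num_real (x _ _))) ler_pXn2r ?nnegrE.
rewrite sumr_const card_ord -[leLHS]mulr_natl exprMn ler_wpM2r ?sqr_ge0//.
case: n => [|m]; first by rewrite expr0n.
by rewrite ler_eXnr// ler1n.
Qed.

Definition eball x r : set 'rV[R]_n := [set y | enorm (y - x) < r].

Lemma measurable_enorm_sub x :
  measurable_fun [set: 'rV[R]_n] (fun y : 'rV[R]_n => enorm (y - x)).
Proof.
apply: (measurableT_comp (@measurable_enorm R n)).
apply/measurable_fun_coordP => i.
under eq_fun do rewrite mxE.
by apply: measurable_funD; [exact: measurable_coord|exact: measurable_cst].
Qed.

Lemma measurable_eball x r : measurable (eball x r).
Proof.
rewrite (_ : eball x r = (fun y : 'rV[R]_n => enorm (y - x)) @^-1` [set` `]-oo, r[]).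
  by rewrite -[X in measurable X]setTI; exact: measurable_enorm_sub.
by apply/seteqP; split => y /=; rewrite in_itv.
Qed.

Lemma eball_center x r : 0 < r -> eball x r x.
Proof. by move=> r0; rewrite /eball/= subrr enorm0. Qed.

Lemma ediam_eball x r : 0 <= r -> (ediam (eball x r) <= (2 * r)%:E)%E.
Proof.
move=> r0; apply: ge_ereal_sup => _ [y By [z Bz <-]]; rewrite lee_fin.
rewrite (le_trans (ler_enorm_dist x _ _))// mulr2n mulrDl mul1r.
by apply: lerD; apply: ltW => //; rewrite enorm_distC.
Qed.

Lemma ediam_ge0 (U : set 'rV[R]_n) : U !=set0 -> (0 <= ediam U)%E.
Proof.
case=> x Ux; apply: ereal_sup_ubound; exists x => //; exists x => //.
by rewrite subrr enorm0.
Qed.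

Lemma enorm_le_ediam (U : set 'rV[R]_n) x y : U x -> U y ->
  ((enorm (x - y))%:E <= ediam U)%E.
Proof. by move=> Ux Uy; apply: ereal_sup_ubound; exists x => //; exists y. Qed.

Lemma diam_pow_ge0 s (U : set 'rV[R]_n) : (0 <= diam_pow s U)%E.
Proof. by rewrite /diam_pow; case: ifP => // _; exact: poweR_ge0. Qed.

Lemma diam_pow_le s r (U : set 'rV[R]_n) : 0 <= s ->
  (ediam U <= r%:E)%E -> (diam_pow s U <= (r `^ s)%:E)%E.
Proof.
move=> s0 Ur; rewrite /diam_pow; case: ifPn => [_|/set0P U0].
  by rewrite lee_fin powR_ge0.
rewrite -poweR_EFin; apply: gt0_ler_poweR => //.
- by rewrite in_itv/= ediam_ge0//= leey.
- by rewrite in_itv/= leey andbT (le_trans (ediam_ge0 U0)).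
Qed.

Lemma hausdorff_premeasure_ge0 s delta (E : set 'rV[R]_n) :
  (0 <= hausdorff_premeasure s delta E)%E.
Proof.
apply: le_ereal_inf_tmp => _ [U _ <-]; apply: nneseries_ge0 => i _ _.
exact: diam_pow_ge0.
Qed.

End enorm_theory.

(** * Covering lemma and upper densities *)

Section vitali.
Context {R : realType} {n : nat}.
Implicit Types (V D : set 'rV[R]_n) (rho : 'rV[R]_n -> R).

(* The subfamily is maximal among the disjoint ones which meet no ball of the
   family without containing a ball at least half as large that meets it. *)
Lemma vitali_eball V rho (r : R) : (forall y, V y -> 0 < rho y <= r) ->
  exists D, [/\ D `<=` V, trivIset D (fun y => eball y (rho y)) &
    V `<=` \bigcup_(y in D) eball y (3 * rho y)].
Proof.
move=> rhor; pose B y := eball y (rho y).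
pose P D := [/\ D `<=` V, trivIset D B &
  forall x, V x -> (forall y, D y -> B x `&` B y = set0) \/
    exists y, [/\ D y, B x `&` B y !=set0 & rho x <= 2 * rho y]].
have [D [[DV tD PD] maxD]] : exists D, P D /\ forall D', D `<` D' -> ~ P D'.
  apply: Zorn_bigcup => F FP totF; split.
  - by move=> x [D /FP[DV _ _]] /DV.
  - move=> x y [D1 FD1 D1x] [D2 FD2 D2y] xy.
    have [D12|D21] := totF _ _ FD1 FD2.
    + by have [_ + _] := FP _ FD2; apply => //; exact: D12.
    + by have [_ + _] := FP _ FD1; apply => //; exact: D21.
  - move=> x Vx; have [h|] := pselect (exists2 D, F D & exists y,
      [/\ D y, B x `&` B y !=set0 & rho x <= 2 * rho y]).
      by case: h => D FD [y [Dy xy rxy]]; right; exists y; split=> //; exists D.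
    move=> h; left => y [D FD Dy]; have [_ _ /(_ _ Vx)[|]] := FP _ FD.
      exact.
    by case=> z Dz; absurd: h; exists D => //; exists z.
exists D; split=> // x Vx.
(* By maximality the first alternative of [P] never occurs: otherwise, among the balls missing those
   of [D], one with radius over half the supremum could be added to [D]. *)
have meetD z : V z -> exists y,
    [/\ D y, B z `&` B y !=set0 & rho z <= 2 * rho y].
  move=> Vz; apply: contrapT => nz.
  pose W := [set y | V y /\ forall w, D w -> B y `&` B w = set0].
  have Wz : W z by split=> //; have [|//] := PD _ Vz.
  have hsW : has_sup (rho @` W).
    split; first by exists (rho z), z.
    by exists r => _ [w [Vw _] <-]; have /andP[] := rhor _ Vw.
  have supW0 : 0 < sup (rho @` W).
    have /andP[rz0 _] := rhor _ Vz.
    rewrite (lt_le_trans rz0)//; apply: ub_le_sup; first exact: hsW.2.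
    by exists z.
  have [_ [w [Vw Ww] <-]] := sup_adherent (divr_gt0 supW0 (ltr0n _ 2)) hsW.
  rewrite {1}(splitr (sup _)) addrK => supw.
  have rw : forall y, W y -> rho y <= 2 * rho w.
    move=> y Wy; rewrite mulrC -ler_pdivrMr// (le_trans _ (ltW supw))//.
    rewrite ler_pM2r ?invr_gt0//; apply: ub_le_sup; first exact: hsW.2.
    by exists y.
  have Bw : B w w by apply: eball_center; have /andP[] := rhor _ Vw.
  apply: (maxD (D `|` [set w])).
    split; first by left.
    move=> /(_ w (or_intror erefl)) /Ww.
    by rewrite setIid => /seteqP[+ _] => /(_ w Bw).
  split.
  - by move=> y [/DV//|->].
  - move=> a b [Da|->] [Db|->] //; first exact: tD.
    + by rewrite setIC Ww// => -[].
    + by rewrite Ww// => -[].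
  - move=> y Vy; have [dy|[a [Da ya rya]]] := PD _ Vy; last first.
      by right; exists a; split=> //; left.
    have [yw|/set0P yw] := eqVneq (B y `&` B w) set0.
      by left => a [Da|->//]; exact: dy.
    by right; exists w; split=> //; [right|exact: rw].
(* Only the centres have to be covered, so [rho x + rho y <= 3 * rho y] suffices, instead of the
   factor 5 for whole balls. *)
have [y [Dy [z [Bxz Byz]] rxy]] := meetD _ Vx.
exists y => //; rewrite /eball/= (le_lt_trans (ler_enorm_dist z _ _))//.
rewrite (_ : 3 * rho y = 2 * rho y + rho y); last by ring.
by apply: ltrD => //; rewrite (lt_le_trans _ rxy)// enorm_distC.
Qed.

(** Each ball contains a vector with rational coordinates, and disjointness makes the choice of such
    a vector injective. *)
Lemma countable_disjoint_eball D rho : (forall y, D y -> 0 < rho y) ->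
  trivIset D (fun y => eball y (rho y)) -> countable D.
Proof.
move=> rho0 tD.
have /choice[f fB] (y : 'rV[R]_n) : exists q : 'rV[rat]_n,
    D y -> eball y (rho y) (map_mx ratr q).
  have [Dy|] := pselect (D y); last by exists 0.
  (* With [n.+1] in the denominator, the [n] coordinate errors add up to strictly less than [rho y],
     also for [n = 0]. *)
  have e0 : 0 < rho y / n.+1%:R by rewrite divr_gt0 ?rho0.
  have /choice[q yq] (i : 'I_n) : exists q : rat,
      `|ratr q - y ord0 i| <= rho y / n.+1%:R.
    have : y ord0 i < y ord0 i + rho y / n.+1%:R by rewrite ltrDl.
    move=> /rat_in_itvoo[q]; rewrite in_itv/= => /andP[yq qy].
    by exists q; rewrite gtr0_norm ?subr_gt0// ltW// ltrBlDl.
  exists (\row_i q i) => _; rewrite /eball/=.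
  rewrite (@le_lt_trans _ _ (n%:R * (rho y / n.+1%:R)))//.
    apply: enorm_le_coord; first exact: ltW.
    by move=> i; rewrite !mxE.
  by rewrite mulrA ltr_pdivrMr// mulrC ltr_pM2l ?rho0// ltr_nat.
apply/countable_injP; exists (pickle \o f) => x y /[!inE] Dx Dy /=.
move=> /(pcan_inj pickleK) fxy; apply: tD => //; exists (map_mx ratr (f x)).
by split; [exact: fB|rewrite fxy; exact: fB].
Qed.

Lemma hausdorff_measure_density (mu : {measure set 'rV[R]_n -> \bar R}) (s : R)
    (E : set 'rV[R]_n) :
  (mu setT < +oo)%E -> 0 <= s ->
  (forall y, E y -> forall M delta : R, 0 < M -> 0 < delta ->
     exists2 rho : R, 0 < rho <= delta & ((M * rho `^ s)%:E <= mu (eball y rho))%E) ->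
  hausdorff_measure s E = 0%E.
Proof.
move=> muoo s0 densE; apply/eqP; rewrite eq_le; apply/andP; split; last first.
  apply: (@le_trans _ _ (hausdorff_premeasure s 1 E)).
    exact: hausdorff_premeasure_ge0.
  by apply: ereal_sup_ubound; exists 1 => //=.
apply: ge_ereal_sup => _ [delta /= delta0 <-].
apply/lee_addgt0Pr => /= e e0; rewrite add0e.
pose A := fine (mu setT).
have muA : mu setT = A%:E by rewrite fineK// ge0_fin_numE.
have A0 : 0 <= A by rewrite fine_ge0.
pose L : R := 6 `^ s.
have L0 : 0 < L by rewrite powR_gt0.
(* The final bound is [L / M * A = e * A / (A + 1)], at most [e]; adding 1 keeps [M] positive when
   [mu] is zero. *)
pose M := L * (A + 1) / e.
have M0 : 0 < M by rewrite divr_gt0// mulr_gt0// ltr_wpDl.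
have /choice[rho rhoP] (y : 'rV[R]_n) : exists rho : R, E y ->
    0 < rho <= delta / 6 /\ ((M * rho `^ s)%:E <= mu (eball y rho))%E.
  have [Ey|] := pselect (E y); last by exists 0.
  have [|rho rd rM] := densE _ Ey M (delta / 6) M0; first by rewrite divr_gt0.
  by exists rho.
have [D [DE tD cD]] := @vitali_eball E rho (delta / 6) (fun y Ey => (rhoP y Ey).1).
have rho0 y : D y -> 0 < rho y by move=> /DE/rhoP[/andP[]].
have /countable_injP[j injj] := countable_disjoint_eball rho0 tD.
(* [U c k] is the ball numbered [k], enlarged by the factor [c], or the empty set if no ball has
   this number. The sets with [c = 3] cover [E]; those with [c = 1] are disjoint. *)
pose U c k := \bigcup_(y in [set y | D y /\ j y = k]) eball y (c * rho y).
have U1 c k y : D y -> j y = k -> U c k = eball y (c * rho y).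
  move=> Dy jy; apply/seteqP; split=> [z [x [Dx jx]]|z zy]; last by exists y.
  by have -> : x = y by apply: injj; rewrite ?inE// jx.
have U0 c k : (forall y, D y -> j y <> k) -> U c k = set0.
  by move=> nk; apply/seteqP; split=> // z [x [/nk]].
have mU c k : measurable (U c k).
  have [[y Dy jy]|nk] := pselect (exists2 y, D y & j y = k).
    by rewrite (U1 _ _ _ Dy jy); exact: measurable_eball.
  by rewrite U0// => y Dy jy; apply: nk; exists y.
have tU : trivIset setT (U 1).
  move=> k l _ _ [z [[x [Dx jx]] + [y [Dy jy]]]]; rewrite !mul1r => zx zy.
  by rewrite -jx -jy; congr j; apply: tD => //; exists z.
apply: (@le_trans _ _ (\sum_(k <oo) diam_pow s (U 3%R k))%E).
  apply: ereal_inf_lbound; exists (U 3) => //; split.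
    by move=> x /cD[y Dy xy]; exists (j y) => //; exists y.
  move=> k; have [[y Dy jy]|nk] := pselect (exists2 y, D y & j y = k).
    have [/andP[ry0 ryd] _] := rhoP _ (DE _ Dy).
    rewrite (U1 _ _ _ Dy jy).
    apply: (@le_trans _ _ (2 * (3 * rho y))%:E).
      by apply: ediam_eball; rewrite mulr_ge0// ltW.
    by rewrite lee_fin mulrA -natrM mulrC -ler_pdivlMr.
  rewrite U0; last by move=> y Dy jy; apply: nk; exists y.
  by apply: ge_ereal_sup => _ [? []].
apply: (@le_trans _ _ (\sum_(k <oo) ((L / M)%:E * mu (U 1%R k)))%E).
  apply: lee_nneseries => [k _ _|k _]; first exact: diam_pow_ge0.
  have [[y Dy jy]|nk] := pselect (exists2 y, D y & j y = k).
    have [/andP[ry0 ryd] ryM] := rhoP _ (DE _ Dy).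
    rewrite !(U1 _ _ _ Dy jy) mul1r.
    apply: (@le_trans _ _ ((6 * rho y) `^ s)%:E).
      apply: diam_pow_le => //; rewrite (_ : 6 * rho y = 2 * (3 * rho y)).
        by apply: ediam_eball; rewrite mulr_ge0// ltW.
      by rewrite mulrA -natrM.
    rewrite powRM ?(ltW ry0)//.
    apply: (@le_trans _ _ ((L / M)%:E * (M * rho y `^ s)%:E)%E).
      by rewrite -EFinM lee_fin mulrA divfK// gt_eqF.
    by rewrite lee_wpmul2l// lee_fin divr_ge0 ?ltW.
  rewrite !U0; try by move=> y Dy jy; apply: nk; exists y.
  by rewrite /diam_pow eqxx measure0 mule0.
rewrite nneseriesZl// -measure_semi_bigcup//; last exact: bigcupT_measurable.
apply: (@le_trans _ _ ((L / M)%:E * A%:E)%E).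
  apply: lee_wpmul2l; first by rewrite lee_fin divr_ge0 ?ltW.
  rewrite -muA.
  by apply: le_measure; rewrite ?inE//; exact: bigcupT_measurable.
rewrite -EFinM lee_fin /M invf_div mulrA mulrC mulrA ler_pdivrMr; last first.
  by rewrite mulr_gt0// ltr_wpDl.
by nra.
Qed.

End vitali.

(** * Upper bound for the dimension *)

Section abs_integral.
Context d (T : measurableType d) (R : realType).
Context (m : {measure set T -> \bar R}) (D : set T) (f : T -> R).
Hypotheses (mD : measurable D) (mf : measurable_fun D f).
Local Open Scope ereal_scope.

(* mD and mf are arguments only so that the measure structure can be inferred. *)
Definition abs_integral of measurable D & measurable_fun D f : set T -> \bar R :=
  fun A => \int[m]_(x in D `&` A) `|f x|%:E.

Local Notation mu := (abs_integral mD mf).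

Let mu0 : mu set0 = 0.
Proof. by rewrite /abs_integral setI0 integral_set0. Qed.

Let mu_ge0 A : 0 <= mu A.
Proof. by apply: integral_ge0 => x _; rewrite lee_fin. Qed.

Let mu_sigma_additive : semi_sigma_additive mu.
Proof.
move=> F mF tF mUF; rewrite /abs_integral setI_bigcupr.
rewrite ge0_integral_bigcup//=.
- by apply: is_cvg_ereal_nneg_natsum_cond => n _ _; exact: mu_ge0.
- by move=> k; exact: measurableI.
- rewrite -setI_bigcupr; apply: (measurable_funS mD); first exact: subIsetl.
  by apply/measurable_EFinP; exact: measurableT_comp.
- exact: trivIset_setIl.
Qed.

HB.instance Definition _ := isMeasure.Build _ _ _ mu
  mu0 mu_ge0 mu_sigma_additive.

End abs_integral.

(** * Dyadic upper bounds for Poisson integrals *)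

Section poisson_theory.
Context {R : realType} {d : nat}.
Implicit Types (x y xi : 'rV[R]_d.+1) (f : 'rV[R]_d.+1 -> R) (r : R).
Local Notation S := (@unit_sphere R d.+1).
Local Notation sigma := (@sphere_measure R d.+1).

Lemma enorm_sub_scaled_ge r y xi : S y -> S xi -> 0 <= r <= 1 ->
  1 - r <= enorm (r *: y - xi).
Proof.
rewrite /unit_sphere/= => y1 xi1 /andP[r0 r1].
have := ler_enormD (xi - r *: y) (r *: y); rewrite subrK xi1 enormZ y1 mulr1.
by rewrite ger0_norm// enorm_distC lerBlDr.
Qed.

Lemma enorm_sub_scaled r y : S y -> 0 <= r <= 1 -> enorm (y - r *: y) = 1 - r.
Proof.
rewrite /unit_sphere/= => y1 /andP[r0 r1].
by rewrite -{1}(scale1r y) -scalerBl enormZ y1 mulr1 ger0_norm// subr_ge0.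
Qed.

Lemma poisson_kernel_ge0 r y xi : S y -> 0 <= r <= 1 ->
  0 <= poisson_kernel (r *: y) xi.
Proof.
rewrite /unit_sphere/= => y1 /andP[r0 r1].
rewrite /poisson_kernel divr_ge0 ?exprn_ge0 ?enorm_ge0// enormZ y1 mulr1.
by rewrite subr_ge0 exprn_ile1// ?normr_ge0// ger0_norm.
Qed.

Lemma measurable_poisson_kernel x :
  measurable_fun [set: 'rV[R]_d.+1] (poisson_kernel x).
Proof.
rewrite (_ : poisson_kernel x = fun xi : 'rV[R]_d.+1 =>
    (1 - enorm x ^+ 2) * (enorm (xi - x) ^+ d.+1) `^ (-1)).
  apply: measurable_funM; first exact: measurable_cst.
  apply: (measurableT_comp (@measurable_powR R (-1))).
  by apply: measurable_funX; exact: measurable_enorm_sub.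
apply/funext => xi; rewrite /poisson_kernel powR_inv1 ?exprn_ge0 ?enorm_ge0//.
by rewrite enorm_distC.
Qed.

(** The condition on [K] makes the last ball contain the whole sphere. The term of the smallest
    dyadic ball containing [xi] already bounds the kernel. *)
Lemma poisson_kernel_le r y xi (K : nat) : S y -> S xi -> 0 <= r < 1 ->
  2 < 2 ^+ K * (1 - r) ->
  poisson_kernel (r *: y) xi <= \sum_(k < K.+1)
    2 * 4 ^+ d.+1 * (1 - r) / (2 ^+ k * (1 - r)) ^+ d.+1 *
      \1_(eball y (2 ^+ k * (1 - r))) xi.
Proof.
move=> Sy Sxi /andP[r0 r1] hK; pose e := 1 - r; rewrite -/e.
have e0 : 0 < e by rewrite subr_gt0.
have r01 : 0 <= r <= 1 by rewrite r0 ltW.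
have xiy : enorm (xi - y) < 2 ^+ K * e.
  rewrite (le_lt_trans _ hK)// (le_trans (ler_enormD _ _))// enormN.
  by rewrite Sxi Sy.
have [k kP kmin] := @ex_minnP (fun k => enorm (xi - y) < 2 ^+ k * e)
  (ex_intro _ K xiy).
have kK : (k < K.+1)%N by rewrite ltnS kmin.
(* If [xi] lies outside the preceding ball, its distance to [y] is at most [e] plus its distance to
   [r *: y], hence at most twice the latter; for [k = 0] the distance to the sphere is enough. *)
have far : 2 ^+ k * e / 4 <= enorm (r *: y - xi).
  case: k kP kmin {kK} => [_ _|k _ kmin].
    rewrite (le_trans _ (enorm_sub_scaled_ge Sy Sxi r01))// expr0 mul1r.
    by rewrite ler_pdivrMr// ler_peMr ?(ltW e0)// ler1n.
  have : 2 ^+ k * e <= enorm (xi - y).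
    by rewrite leNgt; apply/negP => /kmin; rewrite ltnn.
  have := ler_enorm_dist (r *: y) xi y.
  rewrite (enorm_distC (r *: y) y) (enorm_distC xi (r *: y)).
  rewrite (enorm_sub_scaled Sy r01).
  have := enorm_sub_scaled_ge Sy Sxi r01.
  by rewrite exprS; lra.
have nonneg (j : 'I_K.+1) : 0 <= 2 * 4 ^+ d.+1 * e / (2 ^+ j * e) ^+ d.+1 *
    \1_(eball y (2 ^+ j * e)) xi.
  by rewrite !mulr_ge0// ?invr_ge0 ?exprn_ge0// ?mulr_ge0 ?exprn_ge0// ltW.
rewrite (bigD1 (Ordinal kK))//= indicE mem_set//= mulr1.
apply: ler_wpDr; first by apply: sumr_ge0.
rewrite /poisson_kernel enormZ Sy mulr1 ger0_norm//.
have t0 : 0 < 2 ^+ k * e by rewrite mulr_gt0// exprn_gt0.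
apply: (@le_trans _ _ (2 * e / (2 ^+ k * e / 4) ^+ d.+1)).
  apply: ler_pM.
  - by rewrite subr_ge0 exprn_ile1// ltW.
  - by rewrite invr_ge0 exprn_ge0// enorm_ge0.
  - by rewrite /e; nra.
  - rewrite lef_pV2 ?posrE ?exprn_gt0 ?divr_gt0//.
      by apply: lerXn2r; rewrite ?nnegrE ?enorm_ge0// divr_ge0// ltW.
    by rewrite (lt_le_trans _ far)// divr_gt0.
rewrite expr_div_n invf_div.
by rewrite le_eqVlt; apply/orP; left; apply/eqP; ring.
Qed.

Lemma poisson_integral_le f r y K (mS : measurable S) (mf : measurable_fun S f) :
  S y -> 0 <= r < 1 -> 2 < 2 ^+ K * (1 - r) ->
  (`|poisson_integral f (r *: y)|%:E <= \sum_(k < K.+1)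
    (2 * 4 ^+ d.+1 * (1 - r) / (2 ^+ k * (1 - r)) ^+ d.+1)%:E *
      abs_integral sigma mS mf (eball y (2 ^+ k * (1 - r))))%E.
Proof.
move=> Sy r01 hK.
have r01' : 0 <= r <= 1 by case/andP: r01 => -> /ltW.
have mPf : measurable_fun S (fun xi => poisson_kernel (r *: y) xi * f xi).
  apply: measurable_funM => //; apply: measurable_funTS.
  exact: measurable_poisson_kernel.
have mabsf : measurable_fun S (fun xi => `|f xi|).
  exact: measurableT_comp.
pose c k := 2 * 4 ^+ d.+1 * (1 - r) / (2 ^+ k * (1 - r)) ^+ d.+1.
have c0 k : 0 <= c k.
  have e0 : 0 <= 1 - r by rewrite subr_ge0; case/andP: r01'.
  by rewrite /c !mulr_ge0// ?invr_ge0 ?exprn_ge0// mulr_ge0// exprn_ge0.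
have mind k : measurable_fun S (fun xi =>
    `|f xi| * \1_(eball y (2 ^+ k * (1 - r))) xi).
  apply: measurable_funM => //.
  by apply: measurable_indic; exact: measurable_eball.
apply: (@le_trans _ _ (\int[sigma]_(xi in S)
    (\sum_(k < K.+1) (c k)%:E * (`|f xi| * \1_(eball y (2 ^+ k * (1 - r))) xi)%:E))%E).
  apply: (@le_trans _ _
      `|\int[sigma]_(xi in S) (poisson_kernel (r *: y) xi * f xi)%:E|%E).
    (* The real integral is the [fine] of the extended one, so an infinite value becomes 0 and the
       bound persists. *)
    by rewrite /poisson_integral /Rintegral; case: (integral _ _ _) => //=;
      rewrite ?normr0 ?leey.
  apply: (le_trans (le_abse_integral _ _ _)) => //.
    exact/measurable_EFinP.
  apply: ge0_le_integral => //.
  - by apply/measurable_EFinP; exact: measurableT_comp.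
  - apply: emeasurable_sum => k; apply: measurable_funeM.
    exact/measurable_EFinP.
  - move=> xi Sxi /=; rewrite normrM ger0_norm ?poisson_kernel_ge0//.
    under eq_bigr do rewrite -EFinM.
    rewrite sumEFin lee_fin.
    under eq_bigr do rewrite mulrCA.
    rewrite -mulr_sumr mulrC ler_wpM2l//.
    exact: poisson_kernel_le.
rewrite ge0_integral_sum//; last 2 first.
- by move=> k; apply: measurable_funeM; exact/measurable_EFinP.
- move=> k xi _; apply: mule_ge0; first by rewrite lee_fin c0.
  by rewrite lee_fin mulr_ge0.
apply: lee_sum => k _.
rewrite ge0_integralZl_EFin//; last first.
  exact/measurable_EFinP.
apply: lee_wpmul2l; first by rewrite lee_fin c0.
rewrite /abs_integral integral_mkcondr.
rewrite le_eqVlt; apply/orP; left; apply/eqP; apply: eq_integral => xi _.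
rewrite patchE indicE; case: ifPn => _; first by rewrite mulr1.
by rewrite mulr0.
Qed.

Lemma abs_integral_lty f (mS : measurable S) (mf : measurable_fun S f) A :
  L1_sphere f -> measurable A -> (abs_integral sigma mS mf A < +oo)%E.
Proof.
move=> /integrableP[_ foo] mA; apply: le_lt_trans foo => /=.
apply: ge0_subset_integral => //=; first exact: measurableI.
by apply/measurable_EFinP; exact: measurableT_comp.
Qed.

(** With [t = 2 ^+ k * e], the powers of [t] cancel up to [e / t], which is [2^-1 ^+ k], and the
    power [- beta] of [t], at most that of [e]. The geometric series contributes the last factor 2
    of [4 ^+ d.+2]. *)
Lemma dyadic_sum_le (beta e M : R) (K : nat) :
  0 <= beta -> 0 < e -> 0 <= M ->
  \sum_(k < K) 2 * 4 ^+ d.+1 * e / (2 ^+ k * e) ^+ d.+1 *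
    (M * (2 ^+ k * e) `^ (d%:R - beta)) <= 4 ^+ d.+2 * M * e `^ (- beta).
Proof.
move=> b0 e0 M0.
apply: (@le_trans _ _
    (\sum_(k < K) (2 * 4 ^+ d.+1 * M * e `^ (- beta)) * 2^-1 ^+ k)).
  apply: ler_sum => k _; set t := 2 ^+ k * e.
  have et : e <= t by rewrite ler_peMl ?(ltW e0)// exprn_ege1// ler1n.
  have t0 : 0 < t by rewrite (lt_le_trans e0).
  rewrite powRD; last by rewrite (gt_eqF t0) implybT.
  rewrite powR_mulrn ?(ltW t0)// (exprS t) invfM.
  have -> : 2 * 4 ^+ d.+1 * e * (t^-1 / t ^+ d) * (M * (t ^+ d * t `^ (- beta))) =
      2 * 4 ^+ d.+1 * M * t `^ (- beta) * (e / t) * (t ^+ d / t ^+ d) by ring.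
  rewrite divff ?expf_neq0 ?gt_eqF// mulr1.
  have -> : e / t = 2^-1 ^+ k.
    by rewrite /t exprVn invfM mulrCA divff ?mulr1// gt_eqF.
  rewrite ler_wpM2r ?exprn_ge0 ?invr_ge0// ler_wpM2l ?mulr_ge0//.
  rewrite !powRN lef_pV2 ?posrE ?powR_gt0//.
  by apply: ge0_ler_powR => //; rewrite nnegrE ltW.
rewrite -mulr_sumr.
have geo : \sum_(k < K) 2^-1 ^+ k <= 2 :> R.
  have half : `|2^-1| < 1 :> R by rewrite gtr0_norm ?invr_gt0//; lra.
  have := @geometric_le_lim R K 1 2^-1 ler01 _ half.
  rewrite invr_gt0 => /(_ (ltr0n _ 2)).
  rewrite /series/= big_mkord (_ : 1 * (1 - 2^-1)^-1 = 2); last by field; lra.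
  by apply: le_trans; apply: ler_sum => k _; rewrite /= mul1r.
rewrite (le_trans (ler_wpM2l _ geo)) ?mulr_ge0 ?powR_ge0//.
by rewrite le_eqVlt; apply/orP; left; apply/eqP; rewrite (exprS _ d.+1); ring.
Qed.

(** By contradiction: if the density ratios at [y] were bounded at small scales, the dyadic bound
    would keep the limsup at [y] finite. *)
Lemma exceptional_set_density (beta : R) f y (mS : measurable S)
    (mf : measurable_fun S f) :
  0 <= beta <= d%:R -> L1_sphere f -> exceptional_set beta f y ->
  forall M delta : R, 0 < M -> 0 < delta ->
  exists2 rho : R, 0 < rho <= delta &
    ((M * rho `^ (d%:R - beta))%:E <= abs_integral sigma mS mf (eball y rho))%E.
Proof.
move=> /andP[b0 bd] intf [Sy limy] M delta M0 delta0; apply: contrapT => nrho.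
set mu := abs_integral sigma mS mf in nrho *.
pose s := d%:R - beta; have s0 : 0 <= s by rewrite subr_ge0.
pose A := fine (mu setT).
have muA : mu setT = A%:E.
  by rewrite fineK// ge0_fin_numE//; exact: abs_integral_lty.
have A0 : 0 <= A by rewrite fine_ge0.
(* The second summand extends the density bound to radii above [delta], where the total mass [A] is
   the only estimate. *)
pose M' := M + A / delta `^ s.
have M'0 : 0 <= M' by rewrite addr_ge0 ?(ltW M0)// divr_ge0// powR_ge0.
have muM' rho : 0 < rho -> (mu (eball y rho) <= (M' * rho `^ s)%:E)%E.
  move=> rho0; have [rd|dr] := leP rho delta.
    apply: (@le_trans _ _ (M * rho `^ s)%:E).
      rewrite leNgt; apply/negP => /ltW Mmu; apply: nrho.
      by exists rho => //; rewrite rho0.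
    by rewrite lee_fin ler_wpM2r ?powR_ge0// lerDl divr_ge0// powR_ge0.
  apply: (@le_trans _ _ A%:E).
    by rewrite -muA le_measure ?inE//; exact: measurable_eball.
  rewrite lee_fin (@le_trans _ _ (A / delta `^ s * rho `^ s))//.
    rewrite -mulrA ler_peMr// mulrC ler_pdivlMr ?powR_gt0// mul1r.
    by apply: ge0_ler_powR; rewrite ?nnegrE// ltW.
  by rewrite ler_wpM2r ?powR_ge0// lerDr ltW.
have bound r : 0 <= r < 1 ->
    `|poisson_integral f (r *: y)| <= 4 ^+ d.+2 * M' * (1 - r) `^ (- beta).
  move=> r01; have e0 : 0 < 1 - r by rewrite subr_gt0; case/andP: r01.
  (* Since [2 ^+ K > K > 2 / (1 - r)], the ball of index [K] contains the sphere. *)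
  pose K := (Num.truncn (2 / (1 - r))).+1.
  have hK : 2 < 2 ^+ K * (1 - r).
    rewrite -ltr_pdivrMr// (lt_le_trans (truncnS_gt _))//.
    by rewrite -natrX ler_nat ltnW// ltn_expl.
  rewrite -lee_fin (le_trans (poisson_integral_le mS mf Sy r01 hK))//.
  rewrite (@le_trans _ _ (\sum_(k < K.+1)
    (2 * 4 ^+ d.+1 * (1 - r) / (2 ^+ k * (1 - r)) ^+ d.+1 *
      (M' * (2 ^+ k * (1 - r)) `^ s))%:E)%E)//.
    apply: lee_sum => k _; rewrite [leRHS]EFinM; apply: lee_wpmul2l.
      rewrite lee_fin divr_ge0 ?mulr_ge0 ?(ltW e0)// ?exprn_ge0//.
      by rewrite mulr_ge0 ?exprn_ge0// ltW.
    by apply: muM'; rewrite mulr_gt0 ?exprn_gt0.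
  by rewrite sumEFin lee_fin dyadic_sum_le.
suff : (limf_esup (fun r : R =>
    (`|poisson_integral f (r *: y)| / (1 - r) `^ (- beta))%:E) 1^'- <=
    (4 ^+ d.+2 * M')%:E)%E by rewrite limy.
rewrite limf_esupE; apply: ge_ereal_inf.
(* The interval from 0 to 1 is a left neighbourhood of 1, so the supremum over it bounds the
   limsup. *)
exists (ereal_sup ((fun r : R =>
    (`|poisson_integral f (r *: y)| / (1 - r) `^ (- beta))%:E) @`
    [set r | 0 <= r < 1])).
  exists [set r | 0 <= r < 1] => //.
  near=> r; rewrite /=; apply/andP; split; near: r.
    exact: nbhs_left_ge.
  exact: nbhs_left_lt.
apply: ge_ereal_sup => _ [r /= r01 <-].
have e0 : 0 < 1 - r by rewrite subr_gt0; case/andP: r01.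
by rewrite lee_fin ler_pdivrMr ?powR_gt0// bound.
Unshelve. all: by end_near. Qed.

Lemma hausdorff_dim_exceptional_set (beta : R) f :
  0 <= beta <= d%:R -> L1_sphere f ->
  (hausdorff_dim (exceptional_set beta f) <= (d%:R - beta)%:E)%E.
Proof.
move=> bd intf; have mS := @measurable_unit_sphere R d.+1.
have mf : measurable_fun S f.
  by apply/measurable_EFinP; exact: measurable_int intf.
apply: ereal_inf_lbound; exists (d%:R - beta) => //; split.
  by rewrite subr_ge0; case/andP: bd.
apply: (@hausdorff_measure_density _ _ (abs_integral sigma mS mf)).
- exact: abs_integral_lty.
- by rewrite subr_ge0; case/andP: bd.
- by move=> y yE M delta; exact: exceptional_set_density.
Qed.

End poisson_theory.

(** * Measure of spherical balls *)

Section sphere_measure_theory.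
Context {R : realType}.

(** For positive [r] this is the open ball of the sup norm, stated by coordinates so that it splits
    as a product along [rV_cons]. *)
Definition cube n (x : 'rV[R]_n) (r : R) : set 'rV[R]_n :=
  [set y | forall i, `|x ord0 i - y ord0 i| < r].

Lemma measurable_cube n (x : 'rV[R]_n) (r : R) : measurable (cube x r).
Proof.
rewrite (_ : cube x r = \bigcap_k (if insub k is Some i
    then (fun y : 'rV[R]_n => y ord0 i) @^-1` ball (x ord0 i) r else setT)).
  apply: bigcapT_measurable => k; case: insubP => [i _ _|_] //.
  rewrite -[X in measurable X]setTI; apply: measurable_coord => //.
  exact: measurable_ball.
apply/seteqP; split=> [y xy k _|y xy i].
  by case: insubP => [i _ _|//]; exact: xy.
by have := xy i I; rewrite valK.
Qed.

Lemma lebesgue_rV_cube n (x : 'rV[R]_n) (r : R) : 0 <= r ->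
  lebesgue_rV R n (cube x r) = ((r *+ 2) ^+ n)%:E.
Proof.
move=> r0; elim: n x => [|n ih] x /=.
  rewrite diracE mem_set// => -[]//.
rewrite /image_measure /pushforward.
rewrite (_ : _ @^-1` _ =
    cube (rsubmx (x : 'rV[R]_(1 + n))) r `*` ball (x ord0 ord0) r).
  rewrite product_measure1E; [|exact: measurable_cube|exact: measurable_ball].
  by rewrite ih exprSr EFinM; congr (_ * _)%E; exact: lebesgue_measure_ball.
apply/seteqP; split=> [[y t] xy|[y t] [/= xy xt] i].
  split=> /=.
    move=> i; have := xy (rshift 1 i).
    by rewrite /rV_cons [X in _ - X]row_mxEr mxE.
  have := xy (lshift n (ord0 : 'I_1)).
  rewrite /rV_cons [X in _ - X]row_mxEl mxE eqxx mulr1n.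
  by rewrite (_ : lshift n (ord0 : 'I_1) = ord0)//; exact: val_inj.
case: (split_ordP (i : 'I_(1 + n))) => j ->.
  rewrite /rV_cons [X in _ - X]row_mxEl mxE (ord1 j) eqxx mulr1n.
  by rewrite (_ : lshift n (ord0 : 'I_1) = ord0)//; exact: val_inj.
rewrite /rV_cons [X in _ - X]row_mxEr.
by have := xy j; rewrite mxE.
Qed.

Lemma enorm_sub_cube n (x y : 'rV[R]_n) (t : R) : 0 <= t ->
  cube x (t / n.+1%:R) y -> enorm (x - y) <= t.
Proof.
move=> t0 xy; apply: (@le_trans _ _ (n%:R * (t / n.+1%:R))).
  apply: enorm_le_coord; first by rewrite divr_ge0.
  by move=> i; rewrite !mxE ltW.
by rewrite mulrA ler_pdivrMr// mulrC ler_wpM2l// ler_nat.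
Qed.

(** Finite and positive volume of the unit ball makes the inverse [fine] in [sphere_measure] a
    genuine positive normalization. *)
Lemma lebesgue_cball_lty n : (lebesgue_rV R n (unit_cball n) < +oo)%E.
Proof.
apply: (@le_lt_trans _ _ (lebesgue_rV R n (cube 0 2))).
  rewrite le_measure ?inE//; [exact: measurable_unit_cball|
    exact: measurable_cube|].
  move=> x x1 i; rewrite mxE sub0r normrN.
  by rewrite (le_lt_trans (coord_le_enorm x i))// (le_lt_trans x1)// ltr1n.
by rewrite lebesgue_rV_cube// ltry.
Qed.

Lemma lebesgue_cball_gt0 n : (0 < lebesgue_rV R n (unit_cball n))%E.
Proof.
apply: (@lt_le_trans _ _ (lebesgue_rV R n (cube 0 (1 / n.+1%:R)))).
  by rewrite lebesgue_rV_cube// lte_fin exprn_gt0// pmulrn_lgt0.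
rewrite le_measure ?inE//; [exact: measurable_cube|
  exact: measurable_unit_cball|].
move=> x x1; rewrite /unit_cball/= -enormN -sub0r.
exact: enorm_sub_cube x1.
Qed.

Lemma sphere_measure_lty n A : measurable A ->
  (@sphere_measure R n A < +oo)%E.
Proof.
move=> mA; rewrite /sphere_measure/= /mscale/= lte_mul_pinfty//.
rewrite /image_measure /pushforward /mrestr.
apply: le_lt_trans (lebesgue_cball_lty n).
have mB : measurable (@radial_proj R n @^-1` A).
  by rewrite -[X in measurable X]setTI; exact: measurable_radial_proj.
rewrite le_measure ?inE//.
- by apply: measurableI => //; exact: measurable_unit_cball.
- exact: measurable_unit_cball.
Qed.

(** Points near [2^-1 *: x] stay inside the unit ball and away from 0. The point [2 *: y] is within
    [2 * t] of both [x] and the projection of [y]. *)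
Lemma enorm_radial_proj n (x y : 'rV[R]_n) (t : R) :
  unit_sphere n x -> 0 < t <= 1 / 4 -> enorm (2^-1 *: x - y) <= t ->
  [/\ enorm y <= 1, unit_sphere n (radial_proj y) &
      enorm (radial_proj y - x) <= 4 * t].
Proof.
rewrite /unit_sphere/= => x1 /andP[t0 t14] xyt.
have x2 : enorm (2^-1 *: x) = 2^-1.
  by rewrite enormZ x1 mulr1 gtr0_norm// invr_gt0.
have yle : enorm y <= 2^-1 + t.
  have := ler_enormD (2^-1 *: x) (y - 2^-1 *: x).
  rewrite addrC subrK x2 enorm_distC => /le_trans; apply.
  by rewrite lerD2l.
have yge : 2^-1 - t <= enorm y.
  have := ler_enormD (2^-1 *: x - y) y; rewrite subrK x2.
  lra.
have y0 : 0 < enorm y by lra.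
split; first by lra.
  by rewrite /radial_proj enormZ gtr0_norm ?invr_gt0// mulVf// gt_eqF.
apply: le_trans (ler_enorm_dist (2 *: y) _ _) _.
have -> : radial_proj y - 2 *: y = ((enorm y)^-1 - 2) *: y.
  by rewrite /radial_proj scalerBl.
have -> : 2 *: y - x = - 2 *: (2^-1 *: x - y).
  rewrite scalerBr scalerA !scaleNr opprK mulNr divff ?pnatr_eq0// scaleN1r.
  by rewrite addrC.
rewrite !enormZ normrN (gtr0_norm (ltr0n _ 2)).
rewrite -{2}(gtr0_norm y0) -normrM mulrBl mulVf ?gt_eqF//.
have : `|1 - 2 * enorm y| <= 2 * t by rewrite ler_norml; apply/andP; split; lra.
by have := xyt; lra.
Qed.

(** The part of the cone over the spherical ball inside the unit ball contains a small cube around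
    [2^-1 *: x], which has positive volume. *)
Lemma sphere_measure_eball_gt0 n (x : 'rV[R]_n) (r : R) :
  unit_sphere n x -> 0 < r ->
  (0 < sphere_measure n (unit_sphere n `&` eball x r))%E.
Proof.
move=> x1 r0; rewrite /sphere_measure/= /mscale/=.
rewrite mule_gt0//.
  by rewrite lte_fin invr_gt0 fine_gt0// lebesgue_cball_gt0 lebesgue_cball_lty.
rewrite /image_measure /pushforward /mrestr.
(* The projection moves at most [4 * t] away from [x], hence at most [r / 2]. *)
pose t := Num.min (1 / 4) (r / 8).
have t0 : 0 < t by rewrite lt_min !divr_gt0.
have t4 : t <= 1 / 4 by rewrite ge_min lexx.
have tr : t <= r / 8 by rewrite ge_min lexx orbT.
apply: (@lt_le_trans _ _ (lebesgue_rV R n (cube (2^-1 *: x) (t / n.+1%:R)))).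
  rewrite lebesgue_rV_cube ?divr_ge0 ?ltW// lte_fin exprn_gt0// pmulrn_lgt0//.
  by rewrite divr_gt0.
have mB : measurable (@radial_proj R n @^-1` (unit_sphere n `&` eball x r)).
  rewrite -[X in measurable X]setTI; apply: measurable_radial_proj => //.
  by apply: measurableI; [exact: measurable_unit_sphere|exact: measurable_eball].
rewrite le_measure ?inE//; first exact: measurable_cube.
- by apply: measurableI => //; exact: measurable_unit_cball.
- move=> y /(enorm_sub_cube (ltW t0)) xy.
  have [|y1 yS yx] := enorm_radial_proj x1 _ xy; first by rewrite t0.
  split; last exact: y1.
  by split=> //; rewrite /eball/= (le_lt_trans yx)//; lra.
Qed.

End sphere_measure_theory.

(** * Covers by balls *)

Section hausdorff_covers.
Context {R : realType} {n : nat}.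
Implicit Types (E U : set 'rV[R]_n) (x y : 'rV[R]_n) (s : R).

Lemma hausdorff_measure_cover E s (delta e : R) :
  hausdorff_measure s E = 0%E -> 0 < delta -> 0 < e ->
  exists U : (set 'rV[R]_n)^nat, [/\ E `<=` \bigcup_i U i,
    forall i, (ediam (U i) <= delta%:E)%E &
    (\sum_(i <oo) diam_pow s (U i) < e%:E)%E].
Proof.
move=> sE0 delta0 e0.
have /ereal_inf_lt[_ [U [EU Ud] <-] Ue] :
    (hausdorff_premeasure s delta E < e%:E)%E.
  apply: (@le_lt_trans _ _ 0%E); last by rewrite lte_fin.
  by rewrite -sE0; apply: ereal_sup_ubound; exists delta.
by exists U; split.
Qed.

Lemma hausdorff_dim_ge0 E : (0 <= hausdorff_dim E)%E.
Proof. by apply: le_ereal_inf_tmp => _ [s [s0 _] <-]; rewrite lee_fin. Qed.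

(** A covering set is replaced by a ball centred in [E], with positive radius even for a set of
    diameter 0. Raising the exponent from [s0] to [s] is harmless for diameters at most 1 and makes
    [s] positive, so that a small radius costs at most [c]. *)
Lemma diam_pow_cover U E e s0 s (delta c : R) :
  E e -> 0 <= s0 < s -> 0 < delta <= 1 -> (ediam U <= delta%:E)%E -> 0 < c ->
  exists x r, [/\ E x, 0 < r <= delta,
    forall y, E y -> U y -> enorm (y - x) <= r &
    ((r `^ s)%:E <= diam_pow s0 U + c%:E)%E].
Proof.
move=> Ee /andP[s00 s0s] /andP[d0 d1] Ud c0.
have s_gt0 : 0 < s by exact: le_lt_trans s0s.
pose t := Num.min delta (c `^ s^-1).
have t0 : 0 < t by rewrite lt_min d0 powR_gt0.
have td : t <= delta by rewrite ge_min lexx.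
have tc : t `^ s <= c.
  rewrite -[leRHS](powRr1 (ltW c0)) -(mulVf (lt0r_neq0 s_gt0)) powRrM.
  apply: ge0_ler_powR; rewrite ?nnegrE ?powR_ge0 ?(ltW s_gt0) ?(ltW t0)//.
  by rewrite ge_min lexx orbT.
(* A set that misses [E] covers no point of it; the given point [e] then serves as centre. *)
have [UE0|/set0P[x [Ux Ex]]] := eqVneq (U `&` E) set0.
  exists e, t; split=> //; first by rewrite t0.
    by move=> y Ey Uy; have : (U `&` E) y by []; rewrite UE0.
  by rewrite -[leLHS]add0e leeD ?diam_pow_ge0 ?lee_fin.
have U0 : U != set0 by apply/set0P; exists x.
have dU0 : (0 <= ediam U)%E by apply: ediam_ge0; exists x.
pose a := fine (ediam U).
have aU : ediam U = a%:E.
  by rewrite fineK// ge0_fin_numE// (le_lt_trans Ud)// ltry.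
have a0 : 0 <= a by rewrite -lee_fin -aU.
have ad : a <= delta by rewrite -lee_fin -aU.
exists x, (Num.max a t); split=> //.
- by rewrite lt_max t0 orbT ge_max ad td.
- by move=> y Ey Uy; rewrite le_max -lee_fin -aU enorm_le_ediam.
- rewrite /diam_pow (negbTE U0) aU poweR_EFin -EFinD lee_fin.
  rewrite maxEge; case: ifPn => _; last first.
    by rewrite -[leLHS]add0r lerD ?powR_ge0.
  rewrite -[leLHS]addr0 lerD ?(ltW c0)//.
  move: a0; rewrite le_eqVlt => /predU1P[<-|a0].
    by rewrite (powR0 (lt0r_neq0 s_gt0)) powR_ge0.
  by apply: ger_powR; [rewrite a0 (le_trans ad)|exact: ltW].
Qed.

(** Some [s0 < s] has null Hausdorff measure on [E]. Half of [c] pays for the covering sets, the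
    other half for the errors [c / 2 / 2 ^ i.+1] made in passing to balls. *)
Lemma hausdorff_dim_cover E e s (delta c : R) :
  E e -> (hausdorff_dim E < s%:E)%E -> 0 < delta <= 1 -> 0 < c ->
  exists (x : nat -> 'rV[R]_n) (r : nat -> R),
    [/\ forall i, E (x i), forall i, 0 < r i <= delta,
      forall y, E y -> exists i, enorm (y - x i) <= r i &
      (\sum_(i <oo) (r i `^ s)%:E <= c%:E)%E].
Proof.
move=> Ee /ereal_inf_lt[_ [s0 [s00 s0E] <-]]; rewrite lte_fin => s0s d01 c0.
have c20 : 0 < c / 2 by rewrite divr_gt0.
have /andP[d0 _] := d01.
have [U [EU Ud Uc]] := hausdorff_measure_cover s0E d0 c20.
have /choice[xr xrP] i : exists xr : 'rV[R]_n * R, [/\ E xr.1, 0 < xr.2 <= delta,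
    forall y, E y -> U i y -> enorm (y - xr.1) <= xr.2 &
    ((xr.2 `^ s)%:E <= diam_pow s0 (U i) + (c / 2 / (2 ^ i.+1)%:R)%:E)%E].
  have [||x [r h]] := @diam_pow_cover (U i) E e s0 s delta
    (c / 2 / (2 ^ i.+1)%:R) Ee _ d01 (Ud i).
  - by rewrite s00.
  - by rewrite divr_gt0// ltr0n expn_gt0.
  - by exists (x, r).
exists (fst \o xr), (snd \o xr); split=> [i|i|y Ey|] /=.
- by have [] := xrP i.
- by have [] := xrP i.
- by have [i _ Uy] := EU _ Ey; exists i; have [_ _ + _] := xrP i; apply.
- apply: (@le_trans _ _
      (\sum_(i <oo) (diam_pow s0 (U i) + (c / 2 / (2 ^ i.+1)%:R)%:E))%E).
    apply: lee_nneseries => [i _ _|i _]; first by rewrite lee_fin powR_ge0.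
    by have [] := xrP i.
  apply: (le_trans (epsilon_trick _ _ (ltW c20))).
    by move=> i; exact: diam_pow_ge0.
  by rewrite [in leRHS](splitr c) EFinD leeD2r// ltW.
Qed.

End hausdorff_covers.

(** * Functions with a large exceptional set *)

Section singular_density.
Context {R : realType} {d : nat}.
Implicit Types (x y xi : 'rV[R]_d.+1) (f : 'rV[R]_d.+1 -> R) (r : R).
Local Notation S := (@unit_sphere R d.+1).
Local Notation sigma := (@sphere_measure R d.+1).

Let mS : measurable S := @measurable_unit_sphere R d.+1.

Lemma sphere_measure_fine_gt0 x r : S x -> 0 < r ->
  0 < fine (sigma (S `&` eball x r)).
Proof.
move=> Sx r0; rewrite fine_gt0// sphere_measure_eball_gt0//=.
by apply: sphere_measure_lty; apply: measurableI => //; exact: measurable_eball.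
Qed.

(* f is the sum over n and i of the indicators of the balls of centers x n i
   and radii r n i, normalized so that the one with indices n and i has mass
   r n i `^ s, the balls of index n covering E with total mass at most 2^-n. *)
Lemma singular_density (E : set 'rV[R]_d.+1) (s : R) :
  E `<=` S -> E !=set0 -> (hausdorff_dim E < s%:E)%E ->
  exists f, [/\ L1_sphere f, forall xi, 0 <= f xi &
    forall y, E y -> forall kappa : R, 0 < kappa -> exists x r,
      [/\ 0 < r <= kappa, enorm (y - x) <= r &
        ((r `^ s)%:E <= \int[sigma]_(xi in S `&` eball x r) (f xi)%:E)%E]].
Proof.
move=> ES [e Ee] dimE.
pose del n : R := 2^-1 ^+ n.
have half : 0 < (2^-1 : R) <= 1 by rewrite invr_gt0 ltr0n/= invf_le1 ?ler1n.
have del01 n : 0 < del n <= 1.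
  have /andP[h0 h1] := half.
  by rewrite exprn_gt0//= exprn_ile1// ltW.
have c0 n : 0 < (1 / (2 ^ n.+1)%:R : R) by rewrite divr_gt0// ltr0n expn_gt0.
have /choice[xr xrP] n : exists xr : nat -> 'rV[R]_d.+1 * R,
    [/\ forall i, E (xr i).1, forall i, 0 < (xr i).2 <= del n,
      forall y, E y -> exists i, enorm (y - (xr i).1) <= (xr i).2 &
      (\sum_(i <oo) ((xr i).2 `^ s)%:E <= (1 / (2 ^ n.+1)%:R)%:E)%E].
  have [x [r [Ex r0 cov sr]]] := hausdorff_dim_cover Ee dimE (del01 n) (c0 n).
  by exists (fun i => (x i, r i)).
pose x n i := (xr n i).1; pose r n i := (xr n i).2.
have r0 n i : 0 < r n i by have [_ /(_ i)/andP[+ _] _ _] := xrP n.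
have Sx n i : S (x n i) by apply: ES; have [+ _ _ _] := xrP n; exact.
pose B n i := eball (x n i) (r n i).
have mB n i : measurable (B n i) by exact: measurable_eball.
pose w n i := r n i `^ s / fine (sigma (S `&` B n i)).
have w0 n i : 0 <= w n i by rewrite divr_ge0 ?powR_ge0// ltW// sphere_measure_fine_gt0.
have wB n i : ((w n i)%:E * sigma (S `&` B n i) = (r n i `^ s)%:E)%E.
  rewrite -[sigma _]fineK; last first.
    rewrite ge0_fin_numE//; apply: sphere_measure_lty.
    exact: measurableI.
  by rewrite -EFinM divfK// gt_eqF// sphere_measure_fine_gt0.
pose g n i xi := (w n i * \1_(B n i) xi)%:E.
have g0 n i xi : (0 <= g n i xi)%E by rewrite lee_fin mulr_ge0.
have mg n i : measurable_fun S (g n i).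
  apply/measurable_EFinP; apply: measurable_funM; first exact: measurable_cst.
  exact: measurable_indic.
pose G n xi := (\sum_(i <oo) g n i xi)%E.
have G0 n xi : (0 <= G n xi)%E by apply: nneseries_ge0.
have mG n : measurable_fun S (G n) by apply: ge0_emeasurable_sum.
pose F xi := (\sum_(n <oo) G n xi)%E.
have F0 xi : (0 <= F xi)%E by apply: nneseries_ge0.
have mF : measurable_fun S F by apply: ge0_emeasurable_sum.
have intg n i : (\int[sigma]_(xi in S) g n i xi = (r n i `^ s)%:E)%E.
  rewrite -wB; under eq_integral do rewrite /g EFinM.
  rewrite ge0_integralZl_EFin//.
  - by rewrite integral_indic// setIC.
  - by apply/measurable_EFinP; exact: measurable_indic.
have intF : sigma.-integrable S F.
  apply/integrableP; split=> //; apply: (@le_lt_trans _ _ 1%E); last exact: ltry.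
  under eq_integral do rewrite gee0_abs//.
  (* The integral of [F] is the double sum of the s-th powers of the radii, at most the sum of the
     [1 / 2 ^ n.+1], which is 1. *)
  rewrite integral_nneseries//.
  apply: le_trans (@epsilon_trick0 R 1 xpredT ler01).
  apply: lee_nneseries => [n _ _|n _]; first exact: integral_ge0.
  rewrite integral_nneseries//; under eq_eseriesr do rewrite intg.
  by have [] := xrP n.
have gF n i xi : (g n i xi <= F xi)%E.
  apply: (@le_trans _ _ (G n xi)).
    rewrite /G (@nneseriesD1 _ _ i xpredT)//.
    by rewrite leeDl// nneseries_ge0.
  rewrite /F (@nneseriesD1 _ _ n xpredT)//.
  by rewrite leeDl// nneseries_ge0.
(* [F] may be infinite on a null set, where [f] is 0; so [f] dominates each [g n i] only almost
   everywhere. *)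
pose f xi := fine (F xi).
have mf : measurable_fun S (EFin \o f).
  apply/measurable_EFinP; apply: (measurableT_comp _ mF).
  exact: fine_measurable.
have f0 xi : 0 <= f xi by rewrite fine_ge0.
exists f; split=> //.
- apply: (le_integrable mS mf _ intF) => xi _.
  rewrite /= ger0_norm// gee0_abs// /f.
  by have := F0 xi; case: (F xi) => //= _; exact: leey.
- move=> y Ey kappa kappa0.
  have [n nk] : exists n, del n <= kappa.
    exists (Num.truncn (kappa^-1)).+1.
    rewrite /del exprVn -[leRHS]invrK lef_pV2 ?posrE ?invr_gt0 ?exprn_gt0//.
    rewrite (le_trans (ltW (truncnS_gt _)))// -natrX ler_nat.
    exact/ltnW/ltn_expl.
  have [_ rdel /(_ y Ey)[i yxi] _] := xrP n.
  exists (x n i), (r n i); split=> //.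
    by rewrite r0/= (le_trans _ nk)//; have /andP[] := rdel i.
  have mSB : measurable (S `&` B n i) by exact: measurableI.
  rewrite -wB -integral_cst//; apply: ae_ge0_le_integral => //.
  - by move=> xi _; rewrite lee_fin.
  - by move=> xi _; rewrite lee_fin.
  - by apply: (measurable_funS mS) => //; exact: subIsetl.
  - have [N [mN N0 FN]] := integrable_ae mS intF.
    exists N; split=> // xi /= nle; apply: FN => /= Ffin.
    apply: nle => -[Sxi Bxi]; rewrite /f fineK; last exact: Ffin.
    apply: le_trans (gF n i xi); rewrite /g indicE mem_set//.
    by rewrite mulr1.
Qed.

End singular_density.

(** * Lower bounds for Poisson integrals and large exceptional sets *)

Section lower_bound.
Context {R : realType} {d : nat}.
Implicit Types (x y xi : 'rV[R]_d.+1) (f : 'rV[R]_d.+1 -> R) (r : R).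
Local Notation S := (@unit_sphere R d.+1).
Local Notation sigma := (@sphere_measure R d.+1).

Let mS : measurable S := @measurable_unit_sphere R d.+1.

(** A bound uniform in [xi] makes the kernel times an integrable function integrable. *)
Lemma poisson_kernel_bounded r y xi : S y -> S xi -> 0 <= r < 1 ->
  poisson_kernel (r *: y) xi <= (1 - r ^+ 2) / (1 - r) ^+ d.+1.
Proof.
move=> Sy Sxi /andP[r0 r1]; have e0 : 0 < 1 - r by rewrite subr_gt0.
have far : 1 - r <= enorm (r *: y - xi).
  by apply: enorm_sub_scaled_ge => //; rewrite r0 ltW.
rewrite /poisson_kernel enormZ Sy mulr1 ger0_norm// ler_wpM2l//.
  by rewrite subr_ge0 exprn_ile1// ltW.
rewrite lef_pV2 ?posrE ?exprn_gt0//; last exact: lt_le_trans far.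
by apply: lerXn2r; rewrite ?nnegrE ?enorm_ge0// ltW.
Qed.

(** The path from [(1 - r) *: y] to [xi] through [y] and [x] has three legs of length at most [r],
    and the numerator [1 - (1 - r) ^+ 2] is at least [r]. *)
Lemma poisson_kernel_ge x y xi r : S y -> S xi -> 0 < r <= 1 ->
  enorm (y - x) <= r -> eball x r xi ->
  r / (3 * r) ^+ d.+1 <= poisson_kernel ((1 - r) *: y) xi.
Proof.
move=> Sy Sxi /andP[r0 r1] yx xix.
have e01 : 0 <= 1 - r <= 1 by rewrite subr_ge0 r1/= gerBl ltW.
have near : enorm ((1 - r) *: y - xi) <= 3 * r.
  have := ler_enorm_dist y ((1 - r) *: y) xi.
  rewrite (enorm_distC ((1 - r) *: y) y) enorm_sub_scaled// subKr.
  have := ler_enorm_dist x y xi.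
  move: xix; rewrite /eball/= (enorm_distC xi x) => xix.
  by move: yx xix; lra.
have far := enorm_sub_scaled_ge Sy Sxi e01.
have e0 : 0 <= 1 - r by case/andP: e01.
rewrite /poisson_kernel enormZ Sy mulr1 ger0_norm// ler_pM ?(ltW r0)//.
- by rewrite invr_ge0 exprn_ge0// mulr_ge0// ltW.
- by nra.
- rewrite lef_pV2 ?posrE ?exprn_gt0 ?mulr_gt0//.
    by apply: lerXn2r; rewrite ?nnegrE ?enorm_ge0// mulr_ge0// ltW.
  by rewrite (lt_le_trans _ far)// subKr.
Qed.

Lemma poisson_integral_ge f x y r (m : R) : L1_sphere f ->
  (forall xi, 0 <= f xi) -> S y -> 0 < r <= 1 -> enorm (y - x) <= r ->
  (m%:E <= \int[sigma]_(xi in S `&` eball x r) (f xi)%:E)%E ->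
  r / (3 * r) ^+ d.+1 * m <= poisson_integral f ((1 - r) *: y).
Proof.
move=> intf f0 Sy /andP[r0 r1] yx fm.
have mf : measurable_fun S f.
  by apply/measurable_EFinP; exact: measurable_int intf.
have e01 : 0 <= 1 - r < 1 by rewrite subr_ge0 r1/= gtrBl.
have e01' : 0 <= 1 - r <= 1 by case/andP: e01 => -> /ltW.
have P0 xi : 0 <= poisson_kernel ((1 - r) *: y) xi.
  exact: poisson_kernel_ge0.
have mPf : measurable_fun S
    (EFin \o (fun xi => poisson_kernel ((1 - r) *: y) xi * f xi)).
  apply/measurable_EFinP; apply: measurable_funM => //.
  by apply: measurable_funTS; exact: measurable_poisson_kernel.
have mB : measurable (S `&` eball x r).
  by apply: measurableI => //; exact: measurable_eball.
(* Integrability is needed here: otherwise [fine] could turn an infinite Poisson integral into 0 and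
   spoil the lower bound. *)
pose K : R := (1 - (1 - r) ^+ 2) / (1 - (1 - r)) ^+ d.+1.
have intPf : sigma.-integrable S
    (EFin \o (fun xi => poisson_kernel ((1 - r) *: y) xi * f xi)).
  apply: (le_integrable mS mPf _ (integrableZl mS K intf)) => xi Sxi /=.
  have PK := poisson_kernel_bounded Sy Sxi e01.
  have K0 : 0 <= K := le_trans (P0 xi) PK.
  rewrite lee_fin (ger0_norm (mulr_ge0 (P0 xi) (f0 xi))).
  by rewrite (ger0_norm (mulr_ge0 K0 (f0 xi))); exact: ler_wpM2r.
have fin : (\int[sigma]_(xi in S)
    (poisson_kernel ((1 - r) *: y) xi * f xi)%:E)%E \is a fin_num.
  exact: (integrable_fin_num mS intPf).
pose c := r / (3 * r) ^+ d.+1.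
have c0 : 0 <= c by rewrite divr_ge0 ?exprn_ge0 ?mulr_ge0// ltW.
rewrite /poisson_integral /Rintegral -lee_fin fineK// -/c EFinM.
apply: (@le_trans _ _ (\int[sigma]_(xi in S `&` eball x r)
    (poisson_kernel ((1 - r) *: y) xi * f xi)%:E)%E); last first.
  by apply: ge0_subset_integral => // xi _; rewrite lee_fin mulr_ge0.
have mfB : measurable_fun (S `&` eball x r) (EFin \o f).
  apply: (measurable_funS mS); first exact: subIsetl.
  exact/measurable_EFinP.
apply: (@le_trans _ _ (\int[sigma]_(xi in S `&` eball x r)
    (c%:E * (f xi)%:E))%E).
  rewrite ge0_integralZl_EFin//; last by move=> xi _; rewrite lee_fin.
  by apply: lee_wpmul2l => //; rewrite lee_fin.
apply: ge0_le_integral => //.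
- by move=> xi _; rewrite -EFinM lee_fin mulr_ge0.
- exact: measurable_funeM.
- by apply: (measurable_funS mS) => //; exact: subIsetl.
- move=> xi [Sxi Bxi]; rewrite -EFinM lee_fin ler_wpM2r//.
  by apply: (@poisson_kernel_ge x) => //; rewrite r0.
Qed.

(** With [r] as the distance to the sphere, arbitrarily large values in every left neighbourhood of
    1 make each supremum infinite, and so their infimum. *)
Lemma exceptional_setI (beta : R) f y : S y ->
  (forall M kappa : R, 0 < kappa -> exists2 r, 0 < r < kappa &
     M <= `|poisson_integral f ((1 - r) *: y)| / r `^ (- beta)) ->
  exceptional_set beta f y.
Proof.
move=> Sy large; split=> //; rewrite limf_esupE; apply/ereal_inf_pinfty.
move=> _ [V V1 <-]; apply: eq_infty => M.
move: V1; rewrite /at_left /within/= => /nbhs_ballP[kappa /= kappa0 V1].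
have [r /andP[r0 rk] Mr] := large M _ kappa0.
apply: le_ereal_sup_tmp.
exists (`|poisson_integral f ((1 - r) *: y)| / r `^ (- beta))%:E => //.
exists (1 - r); last by rewrite subKr.
apply: V1; last by rewrite gtrBl.
by rewrite /ball/= subKr gtr0_norm.
Qed.

Lemma exceptional_set_cover (beta : R) (E : set 'rV[R]_d.+1) :
  E `<=` S -> (hausdorff_dim E < (d%:R - beta)%:E)%E ->
  exists f, L1_sphere f /\ E `<=` exceptional_set beta f.
Proof.
move=> ES dimE; have [->|/set0P E0] := eqVneq E set0.
  exists (fun=> 0); split; last exact: sub0set.
  exact: integrable0.
have dim0 := hausdorff_dim_ge0 E.
pose a := fine (hausdorff_dim E).
have aE : hausdorff_dim E = a%:E.
  by rewrite fineK// ge0_fin_numE// (lt_trans dimE)// ltry.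
have a0 : 0 <= a by rewrite -lee_fin -aE.
have ab : a < d%:R - beta by rewrite -lte_fin -aE.
pose s := (a + (d%:R - beta)) / 2.
have as_ : a < s by rewrite /s; lra.
pose eta := d%:R - beta - s.
have eta0 : 0 < eta by rewrite /eta /s; lra.
have [|f [intf f0 fE]] := @singular_density R d E s ES E0.
  by rewrite aE lte_fin.
exists f; split=> // y Ey; apply: exceptional_setI; first exact: ES.
move=> M kappa kappa0.
pose L : R := 3 ^+ d.+1 * (`|M| + 1).
have L0 : 0 < L by rewrite mulr_gt0 ?exprn_gt0// ltr_wpDl.
pose k := Num.min (Num.min (kappa / 2) 1) (L `^ (- eta^-1)).
have k0 : 0 < k by rewrite !lt_min divr_gt0// ltr01 powR_gt0.
have [x [r [/andP[r0 rk] yx rf]]] := fE y Ey k k0.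
have /and3P[rkappa r1 rL] : [&& r <= kappa / 2, r <= 1 & r <= L `^ (- eta^-1)].
  by move: rk; rewrite !le_min => /andP[/andP[-> ->] ->].
exists r; first by rewrite r0; lra.
have := poisson_integral_ge intf f0 (ES y Ey) _ yx rf.
rewrite r0 r1 => /(_ isT) Pr.
rewrite powRN invrK.
have rb0 : 0 <= r `^ beta by exact: powR_ge0.
apply: le_trans (ler_wpM2r rb0 (le_trans Pr (ler_norm _))).
(* The exponent [d] splits as [eta + s + beta], by the choice of [eta]. *)
have rE : r ^+ d.+1 = r * (r `^ eta * r `^ s * r `^ beta).
  rewrite exprS -powR_mulrn ?(ltW r0)// -!powRD ?(gt_eqF r0) ?implybT//.
  by congr (_ * _ `^ _); rewrite /eta; ring.
have rs0 : r `^ s != 0 by rewrite gt_eqF// powR_gt0.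
have rbn0 : r `^ beta != 0 by rewrite gt_eqF// powR_gt0.
have reta0 : r `^ eta != 0 by rewrite gt_eqF// powR_gt0.
have -> : r / (3 * r) ^+ d.+1 * r `^ s * r `^ beta = (3 ^+ d.+1 * r `^ eta)^-1.
  rewrite exprMn rE; field.
  by rewrite reta0 rbn0 rs0 expf_neq0 ?pnatr_eq0//= gt_eqF.
have reta : r `^ eta <= L^-1.
  rewrite -[leRHS](powR_inv1 (ltW L0)) -(mulVf (lt0r_neq0 eta0)) -mulNr powRrM.
  by apply: ge0_ler_powR; rewrite ?nnegrE ?powR_ge0// ltW.
apply: (@le_trans _ _ (`|M| + 1)).
  by rewrite (le_trans (ler_norm _))// lerDl.
rewrite -(invrK (`|M| + 1)) lef_pV2 ?posrE ?invr_gt0 ?mulr_gt0 ?exprn_gt0//.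
- by rewrite mulrC -ler_pdivlMr ?exprn_gt0// -invfM mulrC.
- by rewrite powR_gt0.
Qed.

End lower_bound.

Theorem theorem1 (R : realType) (d : nat) (beta : R) :
  (1 <= d)%N -> 0 <= beta <= d%:R ->
  (forall f : 'rV[R]_d.+1 -> R, L1_sphere f ->
     (hausdorff_dim (exceptional_set beta f) <= (d%:R - beta)%:E)%E) /\
  (forall E : set 'rV[R]_d.+1, E `<=` unit_sphere d.+1 ->
     (hausdorff_dim E < (d%:R - beta)%:E)%E ->
     exists f : 'rV[R]_d.+1 -> R,
       L1_sphere f /\ E `<=` exceptional_set beta f).
Proof.
move=> _ bd; split=> [f|E]; first exact: hausdorff_dim_exceptional_set.
exact: exceptional_set_cover.
Qed.
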